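(* Let $\mathbb{F}=\mathbb{R}$ or $\mathbb{C}$ and let $\mathfrak{g}$ be an $n$-dimensional Lie algebra over $\mathbb{F}$ with basis $e_1,\ldots,e_n$ and commutation relations $[e_k,e_l]=0$, $[e_k,e_n]=\sum_{l=1}^{n-1}m_{lk}e_l$ for $k,l=1,\ldots,n-1$, where the $(n-1)\times(n-1)$ matrix $M=(m_{kl})$ is a direct sum of $s$ blocks, the $i$-th of which is either a Jordan block $J_{\lambda_i}^{r_i}$ (with $\lambda_i\in\mathbb{F}$) or, if $\mathbb{F}=\mathbb{R}$, possibly a real Jordan block $R_{\mu_i\nu_i}^{2r_i}$ (with $\mu_i,\nu_i\in\mathbb{R}$, $\nu_i\ne0$). Assume that no block is $J_0^1$. Let $\rho_i$ be the sum of the sizes of the blocks preceding the $i$-th one, so that the $i$-th block acts on the span of $e_{\rho_i+1},e_{\rho_i+2},\ldots$ Then for any two different blocks, with numbers $i\neq j$, the following is an invariant (generalized Casimir operator) of $\mathfrak{g}$. (A) Blocks $J_{\lambda_i}^{r_i}$, $J_{\lambda_j}^{r_j}$: (A1) if $\lambda_i\ne0$, $\lambda_j\neq0$: $\ e_{\rho_i+1}^{-\lambda_j}e_{\rho_j+1}^{\lambda_i}$; (A2) if $r_i\geqslant2$, $\lambda_i=0$, $r_j\geqslant2$, $\lambda_j=0$: $\ e_{\rho_j+2}e_{\rho_i+1}-e_{\rho_i+2}e_{\rho_j+1}$; (A3) if $r_i\geqslant2$, $\lambda_i\neq0$, $r_j\geqslant2$, $\lambda_j=0$: $\ \dfrac{e_{\rho_j+2}}{e_{\rho_j+1}}-\dfrac{e_{\rho_i+2}}{e_{\rho_i+1}}$;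 (A4) if $r_i=1$, $\lambda_i\ne0$, $r_j\geqslant2$, $\lambda_j=0$: $\ e_{\rho_i+1}\exp\Bigl(-\lambda_i\dfrac{e_{\rho_j+2}}{e_{\rho_j+1}}\Bigr)$. (B) Blocks $J_{\lambda_i}^{r_i}$, $R_{\mu_j\nu_j}^{2r_j}$, $\lambda_i,\mu_j,\nu_j\in\mathbb{R}$, $\nu_j\neq0$: (B1) if $r_i\geqslant2$, $r_j\geqslant2$: $\ \dfrac{e_{\rho_j+1}e_{\rho_j+3}+e_{\rho_j+2}e_{\rho_j+4}}{e_{\rho_j+1}^2+e_{\rho_j+2}^2}-\dfrac{e_{\rho_i+2}}{e_{\rho_i+1}}$; (B2) if $r_i=1$ or $r_j=1$: $\ e_{\rho_i+1}\exp\Bigl(-\dfrac{\lambda_i}{\nu_j}\arctan\dfrac{e_{\rho_j+2}}{e_{\rho_j+1}}\Bigr)$. (C) Blocks $R_{\mu_i\nu_i}^{2r_i}$, $R_{\mu_j\nu_j}^{2r_j}$, $\mu_i,\nu_i,\mu_j,\nu_j\in\mathbb{R}$, $\nu_i\nu_j\ne0$: (C1) if $r_i\geqslant2$, $r_j\geqslant2$: $\ \dfrac{e_{\rho_j+1}e_{\rho_j+3}+e_{\rho_j+2}e_{\rho_j+4}}{e_{\rho_j+1}^2+e_{\rho_j+2}^2}-\dfrac{e_{\rho_i+1}e_{\rho_i+3}+e_{\rho_i+2}e_{\rho_i+4}}{e_{\rho_i+1}^2+e_{\rho_i+2}^2}$; (C2) if $r_i=1$ or $r_j=1$: $\ \n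u_i\arctan\dfrac{e_{\rho_j+2}}{e_{\rho_j+1}}-\nu_j\arctan\dfrac{e_{\rho_i+2}}{e_{\rho_i+1}}$.
   Context: $J_\lambda^k$ is the $k\times k$ Jordan block with $\lambda$ on the diagonal, $1$ in the positions $(i,i+1)$ and $0$ elsewhere. $R_{\mu\nu}^{2}=\begin{pmatrix}\mu&\nu\\-\nu&\mu\end{pmatrix}$, and $R_{\mu\nu}^{2k}$ is the $2k\times 2k$ matrix consisting of $k\times k$ blocks of size $2\times2$, with $R_{\mu\nu}^2$ on the block diagonal, the $2\times2$ identity matrix in the block positions $(i,i+1)$, and zero blocks elsewhere. For a finite-dimensional Lie algebra $\mathfrak{g}$ with basis $e_1,\ldots,e_n$, $[e_i,e_j]=c_{ij}^ke_k$, let $x_1,\ldots,x_n$ be the coordinates on $\mathfrak{g}^*$ associated with the dual basis. An invariant of the coadjoint action is a (possibly only locally defined, on a connected open set) smooth (analytic if $\mathbb{F}=\mathbb{C}$) function $F(x_1,\ldots,x_n)$ invariant under the coadjoint action, equivalently $\sum_{j,k}c_{ij}^kx_k\,\partial F/\partial x_j=0$ for all $i$. Generalized Casimir operators (invariants of $\mathfrak{g}$) are obtained from such $F$ by replacing $x_i$ by $e_i$ (with symmetrization of non-commuting products); here only the mutually commuting elements $e_1,\ldots,e_{n-1}$ occur, so $e_i$ may simply be read as the coordinate $x_i$. Complex powers are understood as local branches. *)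

(* Defs.v *)
From mathcomp Require Import all_boot all_order all_algebra.
From mathcomp Require Import complex.
From mathcomp Require Import all_classical all_reals all_analysis.

Set Implicit Arguments.
Unset Strict Implicit.
Unset Printing Implicit Defensive.

Import Order.TTheory GRing.Theory Num.Theory.
Import numFieldNormedType.Exports.

Local Open Scope classical_set_scope.
Local Open Scope ring_scope.

Definition is_lie_bracket (K : fieldType) (g : vectType K)
    (br : g -> g -> g) : Prop :=
  [/\ forall (a : K) (u v w : g), br (a *: u + v) w = a *: br u w + br v w,
      forall (a : K) (u v w : g), br u (a *: v + w) = a *: br u v + br u w,
      forall u : g, br u u = 0
    & forall u v w : g, br u (br v w) + br v (br w u) + br w (br u v) = 0].

Definition struct_const (K : fieldType) (g : vectType K) (n : nat)
    (br : g -> g -> g) (e : n.-tuple g) (i j k : 'I_n) : K :=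
  coord e k (br (tnth e i) (tnth e j)).

(* A functional on the Lie algebra is represented by its row of coordinates
   x_1, ..., x_n on the dual space, i.e. its values on the basis. *)

Definition domain (K : numFieldType) (n : nat) (U : set 'rV[K]_n.+1) : Prop :=
  open U /\ connected U.

Definition continuous_on (K : numFieldType) (n : nat) (U : set 'rV[K]_n.+1)
    (F : 'rV[K]_n.+1 -> K) : Prop :=
  forall x, U x -> {for x, continuous F}.

Definition partial (K : numFieldType) (n : nat) (j : 'I_n.+1)
    (F : 'rV[K]_n.+1 -> K) : 'rV[K]_n.+1 -> K :=
  fun x => 'D_(delta_mx ord0 j) F x.

Fixpoint Ck_on (K : numFieldType) (n : nat) (k : nat) (U : set 'rV[K]_n.+1)
    (F : 'rV[K]_n.+1 -> K) : Prop :=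
  match k with
  | 0%N => continuous_on U F
  | k'.+1 => (forall x, U x -> differentiable F x)
             /\ (forall j : 'I_n.+1, Ck_on k' U (partial j F))
  end.

(* For [U] open.  Derivatives are taken over [K]: for a real field this is
   C^oo on [U], while for [K = R[i]] they are complex derivatives, so this is
   holomorphy, i.e. analyticity, on [U]. *)
Definition smooth_on (K : numFieldType) (n : nat) (U : set 'rV[K]_n.+1)
    (F : 'rV[K]_n.+1 -> K) : Prop :=
  forall k : nat, Ck_on k U F.

Definition coadjoint_invariant (K : numFieldType) (g : vectType K) (n : nat)
    (br : g -> g -> g) (e : n.+1.-tuple g) (U : set 'rV[K]_n.+1)
    (F : 'rV[K]_n.+1 -> K) : Prop :=
  [/\ domain U, smooth_on U F
    & forall x, U x -> forall i : 'I_n.+1,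
        \sum_(j < n.+1) \sum_(k < n.+1)
          struct_const br e i j k * x ord0 k * partial j F x = 0].

(* [Jordan r lam] is J_lam^r, and [RealJordan r mu nu] is R_{mu nu}^{2r},
   of size 2r. *)
Inductive block (K : Type) : Type :=
  | Jordan (r : nat) (lam : K)
  | RealJordan (r : nat) (mu nu : K).

Definition bsize (K : Type) (B : block K) : nat :=
  match B with
  | Jordan r _ => r
  | RealJordan r _ _ => r.*2
  end.

Definition J_mx (K : numFieldType) (r : nat) (lam : K) : 'M[K]_r :=
  \matrix_(p < r, q < r)
    (if q == p :> nat then lam else if q == p.+1 :> nat then 1 else 0).

Definition R2_mx (K : numFieldType) (mu nu : K) : 'M[K]_2 :=
  \matrix_(p < 2, q < 2)
    (if p == q then mu else if (p < q)%N then nu else - nu).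

(* Row p lies in the block row p./2, at the position p %% 2 inside the block;
   likewise for columns. *)
Definition R_mx (K : numFieldType) (r : nat) (mu nu : K) : 'M[K]_(r.*2) :=
  \matrix_(p < r.*2, q < r.*2)
    (let p' : 'I_2 := inord (p %% 2) in let q' : 'I_2 := inord (q %% 2) in
     if q./2 == p./2 then R2_mx mu nu p' q'
     else if q./2 == (p./2).+1 then (1%:M : 'M[K]_2) p' q' else 0).

Definition block_matrix (K : numFieldType) (B : block K) : 'M[K]_(bsize B) :=
  match B return 'M[K]_(bsize B) with
  | Jordan r lam => J_mx r lam
  | RealJordan r mu nu => R_mx r mu nu
  end.

Definition admissible (K : numFieldType) (B : block K) : Prop :=
  match B with
  | Jordan r lam => (0 < r)%N /\ ~ (r = 1%N /\ lam = 0)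
  | RealJordan r mu nu => (0 < r)%N /\ nu <> 0
  end.

Definition total_size (K : Type) (s : nat) (b : 'I_s -> block K) : nat :=
  (\sum_(i < s) bsize (b i))%N.

Definition direct_sum (K : numFieldType) (s : nat) (b : 'I_s -> block K) :
    'M[K]_(total_size b) :=
  \mxdiag_(i < s) block_matrix (b i).

Definition rho (K : Type) (s : nat) (b : 'I_s -> block K) (i : 'I_s) : nat :=
  (\sum_(k < s | (k < i)%N) bsize (b k))%N.

(* The Lie algebra with basis e_1, ..., e_n, n = N + 1, and relations
   [e_k, e_l] = 0, [e_k, e_n] = sum_l m_{lk} e_l for k, l <= N. *)
Definition almost_abelian (K : fieldType) (g : vectType K) (N : nat)
    (br : g -> g -> g) (e : N.+1.-tuple g) (M : 'M[K]_N) : Prop :=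
  let E (k : 'I_N) : g := tnth e (widen_ord (leqnSn N) k) in
  let En : g := tnth e ord_max in
  [/\ is_lie_bracket br,
      basis_of fullv e,
      forall k l : 'I_N, br (E k) (E l) = 0
    & forall k : 'I_N, br (E k) En = \sum_(l < N) M l k *: E l].

(* The coordinate written e_{rho_i + m}, with m >= 1, in the 1-based numbering
   of the basis; [inord] does not truncate when m <= bsize (b i). *)
Definition block_coord (K : numFieldType) (s : nat) (b : 'I_s -> block K)
    (i : 'I_s) (m : nat) (x : 'rV[K]_(total_size b).+1) : K :=
  x ord0 (inord (rho b i + m).-1).

Definition cexp (R : realType) (z : R[i]) : R[i] :=
  Complex (expR (complex.Re z) * cos (complex.Im z))
          (expR (complex.Re z) * sin (complex.Im z)).

(* p is a real branch of f^a on U.  If f > 0 the principal one is [f x `^ a].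
   For f < 0 the real values of f^a, when there are any (e.g. if a is an
   integer), are +- |f|^a. *)
Definition real_power_branch (R : realType) (n : nat) (U : set 'rV[R]_n.+1)
    (f : 'rV[R]_n.+1 -> R) (a : R) (p : 'rV[R]_n.+1 -> R) : Prop :=
  exists sgn : bool, forall x, U x ->
    f x != 0 /\ p x = (-1) ^+ sgn * `|f x| `^ a.

(* p = exp (a L) for a continuous branch L of log f on U. *)
Definition complex_power_branch (R : realType) (n : nat)
    (U : set 'rV[R[i]]_n.+1) (f : 'rV[R[i]]_n.+1 -> R[i]) (a : R[i])
    (p : 'rV[R[i]]_n.+1 -> R[i]) : Prop :=
  exists L : 'rV[R[i]]_n.+1 -> R[i],
    continuous_on U L
    /\ (forall x, U x -> cexp (L x) = f x /\ p x = cexp (a * L x)).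

(* Main.v *)
Require Import Defs.
From mathcomp Require Import all_boot all_order all_algebra.
From mathcomp Require Import complex.
From mathcomp Require Import all_classical all_reals all_analysis.
From mathcomp Require Import ring lra.
Import Order.TTheory GRing.Theory Num.Theory.
Import numFieldNormedType.Exports.
Local Open Scope classical_set_scope.
Local Open Scope ring_scope.

(* Write x for the row of the coordinates x_1, ..., x_(n-1).  Modulo d/dx_n,
   which kills all the candidates, the vector fields of the coadjoint action
   are multiples of the linear field V = x M.  On a Jordan block
   V x_1 = lambda x_1 and V x_2 = lambda x_2 + x_1, so V (log x_1) = lambda and V (x_2 / x_1) = 1.  On a real Jordan block put
   z_1 = x_1 + i x_2 and z_2 = x_3 + i x_4: then V z_1 = (mu + i nu) z_1 and
   V z_2 = (mu + i nu) z_2 + z_1, so V (arg z_1) = nu and V (Re (z_2 / z_1)) = 1.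
   Every candidate combines two such functions, one for each block, so that
   the constants cancel. *)

Set Implicit Arguments.
Unset Strict Implicit.
Unset Printing Implicit Defensive.

(** * Smooth functions *)

(** Two difficulties lie outside the computation with V. [smooth_on] asks for derivatives of every
    order, real or complex according to the field, so the closure properties are proved over an
    arbitrary [numFieldType], and exponentials and powers enter only through differential equations:
    E' = E, and p' = p a f' / f for a power of f with exponent a. Moreover, a complex power comes
    only with a continuous logarithm L; that L is differentiable has to be extracted from
    [cexp (L x) = f x]. Carathéodory's criterion does this, the slope of [cexp] at L x being
    continuous and nonzero there. Complex differentiability of [cexp] follows from real estimates at
    0 and multiplicativity. *)

Section Differentiability.
Context {K : numFieldType} {V : normedModType K}.
Implicit Types (F G f g : V -> K) (x v : V).

(** Carathéodory's criterion relative to f. The remainder of F is g times the remainder of f, plus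
    the variation of g times ['d f x h]; the first is small because g is bounded near x, the second
    because ['d f x] is Lipschitz. *)
Lemma caratheodory_is_diff F f g x :
  differentiable f x -> {for x, continuous g} ->
  (\forall y \near x, F y - F x = g y * (f y - f x)) ->
  is_diff x F (g x \*: 'd f x).
Proof.
move=> df cg Ffg.
have cdf : continuous (g x \*: 'd f x).
  by move=> y; apply: continuousZl_tmp; exact: diff_continuous.
have dF : F \o shift x = cst (F x) + (g x \*: 'd f x) +o_ 0 id.
  have [k k0 kP] : exists2 k, k > 0 & forall h, `|'d f x h| <= k * `|h|.
    by apply: linear_lipschitz; exact: diff_continuous.
  have /eqaddoP dfP := diff_locally df.
  apply/eqaddoP => e e0; rewrite near_simpl.
  (* [|g x| + 1] bounds g near x and stays positive when g x = 0, so it can divide the tolerance;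
     each of the two error terms receives e / 2. *)
  have M0 : 0 < `|g x| + 1 by rewrite ltr_wpDl.
  have {}dfP : \forall h \near 0,
      `|f (h + x) - (f x + 'd f x h)| <= e / 2 / (`|g x| + 1) * `|h|.
    by apply: dfP; rewrite !divr_gt0.
  have near_shift0 (P : V -> Prop) :
      (\forall y \near x, P y) -> \forall h \near 0, P (h + x).
    by rewrite (near_shift 0) subr0.
  have near_g (d : K) : 0 < d -> \forall y \near x, `|g x - g y| < d.
    by move/cvgrPdist_lt: cg => /[apply].
  have g1 : \forall h \near 0, `|g x - g (h + x)| < 1.
    exact: (near_shift0 _ (near_g _ ltr01)).
  have ge : \forall h \near 0, `|g x - g (h + x)| < e / 2 / k.
    by apply: (near_shift0 _ (near_g _ _)); rewrite !divr_gt0.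
  have {}Ffg := near_shift0 _ Ffg.
  near=> h.
  have -> : (F \o shift x - (cst (F x) + (g x \*: 'd f x))) h
      = g (h + x) * (f (h + x) - (f x + 'd f x h))
        - (g x - g (h + x)) * 'd f x h.
    have -> : (F \o shift x - (cst (F x) + (g x \*: 'd f x))) h
      = (F (h + x) - F x) - g x * 'd f x h.
      by rewrite -addrA -opprD.
    by rewrite (near Ffg h) //; ring.
  rewrite (le_trans (ler_normB _ _))// !normrM (splitr e) mulrDl lerD//.
    apply: (@le_trans _ _ ((`|g x| + 1) * (e / 2 / (`|g x| + 1) * `|h|))).
      apply: ler_pM => //; last by near: h.
      have -> : g (h + x) = g x - (g x - g (h + x)) by ring.
      rewrite (le_trans (ler_normB _ _))// lerD2l ltW//; near: h; exact: g1.
    by rewrite mulrA [_ * (_ / _)]mulrC divfK ?gt_eqF.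
  apply: (@le_trans _ _ (e / 2 / k * (k * `|h|))).
    by apply: ler_pM => //; apply: ltW; near: h.
  by rewrite mulrA divfK ?gt_eqF.
by apply: DiffDef; [apply/diff_locallyP; rewrite (diff_unique cdf dF)|
  exact: diff_unique].
Unshelve. all: by end_near. Qed.

(** The criterion with constant factor 1. It is what allows functions prescribed only on an open
    set, such as branches, to be replaced by explicit formulas. *)
Lemma near_eq_differentiable F G x :
  (\forall y \near x, F y = G y) -> differentiable F x -> differentiable G x.
Proof.
move=> FG dF.
suff : is_diff x G (1 \*: 'd F x) by case.
apply: (@caratheodory_is_diff G F (cst 1)) => //; first exact: cst_continuous.
by near=> y; rewrite mul1r (nbhs_singleton FG) (near FG y).
Unshelve. all: by end_near. Qed.

Lemma derive_comp1 (phi : K -> K) (dphi : K) F x v :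
  differentiable F x -> is_derive (F x) 1 phi dphi ->
  'D_v (fun y => phi (F y)) x = dphi * 'D_v F x.
Proof.
move=> dF [/derivable1_diffP dphi1 <-].
rewrite (deriveE _ (differentiable_comp dF dphi1)) (deriveE v dF).
by rewrite (diff_comp dF dphi1) /= diff1E// derive1E mulrC.
Qed.

Lemma differentiable_comp1 (phi : K -> K) (dphi : K) F x :
  differentiable F x -> is_derive (F x) 1 phi dphi ->
  differentiable (fun y => phi (F y)) x.
Proof.
by move=> dF [/derivable1_diffP dphi1 _]; exact: (differentiable_comp dF dphi1).
Qed.

End Differentiability.

Section Smoothness.
Context {K : numFieldType} {n : nat} (U : set 'rV[K]_n.+1).
Hypothesis oU : open U.
Implicit Types (F G f : 'rV[K]_n.+1 -> K) (j : 'I_n.+1) (k : nat).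

Lemma near_open_eq F G : (forall x, U x -> F x = G x) ->
  forall x, U x -> \forall y \near x, F y = G y.
Proof. by move=> FG x Ux; near=> y; apply: FG; near: y; exact: open_nbhs_nbhs.
Unshelve. all: by end_near. Qed.

Lemma partial_eq_on F G j : (forall x, U x -> F x = G x) ->
  forall x, U x -> partial j F x = partial j G x.
Proof. by move=> FG x Ux; apply: near_eq_derive; exact: near_open_eq. Qed.

Lemma Ck_on_eq k F G : (forall x, U x -> F x = G x) -> Ck_on k U F -> Ck_on k U G.
Proof.
elim: k F G => [|k IHk] F G FG /=.
  move=> cF x Ux; change (G @ x --> G x); rewrite -(FG x Ux).
  exact: cvg_trans (near_eq_cvg (near_open_eq FG Ux)) (cF x Ux).
move=> [dF pF]; split=> [x Ux|j].
  by apply: near_eq_differentiable (dF x Ux); exact: near_open_eq.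
by apply: IHk (pF j); exact: partial_eq_on.
Qed.

Lemma Ck_on_pred k F : Ck_on k.+1 U F -> Ck_on k U F.
Proof.
elim: k F => [|k IHk] F [dF pF].
  by move=> x Ux; apply: differentiable_continuous; exact: dF.
by split=> // j; exact: IHk.
Qed.

Lemma Ck_on_cst k (a : K) : Ck_on k U (fun=> a).
Proof.
elim: k a => [|k IHk] a /=; first by move=> x _; exact: cst_continuous.
split=> [x _|j]; first exact: differentiable_cst.
by apply: Ck_on_eq (IHk 0) => x _; rewrite /partial derive_cst.
Qed.

Lemma Ck_onD k F G : Ck_on k U F -> Ck_on k U G -> Ck_on k U (fun x => F x + G x).
Proof.
elim: k F G => [|k IHk] F G /=.
  by move=> cF cG x Ux; exact: (cvgD (cF x Ux) (cG x Ux)).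
move=> [dF pF] [dG pG]; split=> [x Ux|j].
  by apply: differentiableD; [exact: dF|exact: dG].
apply: Ck_on_eq (IHk _ _ (pF j) (pG j)) => x Ux.
by rewrite /partial deriveD//; apply: diff_derivable; [exact: dF|exact: dG].
Qed.

Lemma Ck_onM k F G : Ck_on k U F -> Ck_on k U G -> Ck_on k U (fun x => F x * G x).
Proof.
elim: k F G => [|k IHk] F G.
  by move=> cF cG x Ux; exact: (cvgM (cF x Ux) (cG x Ux)).
move=> CF CG; have [dF pF] := CF; have [dG pG] := CG; split=> [x Ux|j].
  by apply: differentiableM; [exact: dF|exact: dG].
apply: (@Ck_on_eq _ (fun x => F x * partial j G x + G x * partial j F x)).
  move=> x Ux; rewrite /partial deriveM//; apply: diff_derivable;
    [exact: dF|exact: dG].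
apply: Ck_onD.
  exact: IHk (Ck_on_pred CF) (pG j).
exact: IHk (Ck_on_pred CG) (pF j).
Qed.

Lemma Ck_onV k F : (forall x, U x -> F x != 0) -> Ck_on k U F ->
  Ck_on k U (fun x => (F x)^-1).
Proof.
move=> F0; elim: k => [|k IHk].
  by move=> cF x Ux; exact: (cvgV (F0 x Ux) (cF x Ux)).
move=> CF; have [dF pF] := CF; split=> [x Ux|j].
  by apply: differentiableV; [exact: dF|exact: F0].
(* The partials of 1/F are - F^(-2) times those of F: they involve 1/F only at order k, which the
   induction hypothesis supplies. *)
have CV := IHk (Ck_on_pred CF).
apply: (@Ck_on_eq _ (fun x => (-1 * ((F x)^-1 * (F x)^-1)) * partial j F x)).
  move=> x Ux; rewrite /partial deriveV ?F0//; last exact/diff_derivable/dF.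
  by rewrite mulN1r expr2 invfM.
exact: Ck_onM (Ck_onM (Ck_on_cst _ _) (Ck_onM CV CV)) (pF j).
Qed.

Lemma smooth_on_eq F G : (forall x, U x -> F x = G x) ->
  smooth_on U F -> smooth_on U G.
Proof. by move=> FG sF k; exact: Ck_on_eq (sF k). Qed.

Lemma smooth_on_differentiable F : smooth_on U F ->
  forall x, U x -> differentiable F x.
Proof. by move=> /(_ 1%N) []. Qed.

Lemma smooth_on_partial j F : smooth_on U F -> smooth_on U (partial j F).
Proof. by move=> sF k; have [_ /(_ j)] := sF k.+1. Qed.

Lemma smooth_on_cst (a : K) : smooth_on U (fun=> a).
Proof. by move=> k; exact: Ck_on_cst. Qed.

Lemma smooth_onD F G : smooth_on U F -> smooth_on U G ->
  smooth_on U (fun x => F x + G x).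
Proof. by move=> sF sG k; exact: Ck_onD. Qed.

Lemma smooth_onM F G : smooth_on U F -> smooth_on U G ->
  smooth_on U (fun x => F x * G x).
Proof. by move=> sF sG k; exact: Ck_onM. Qed.

Lemma smooth_onV F : (forall x, U x -> F x != 0) -> smooth_on U F ->
  smooth_on U (fun x => (F x)^-1).
Proof. by move=> F0 sF k; exact: Ck_onV. Qed.

Lemma smooth_onN F : smooth_on U F -> smooth_on U (fun x => - F x).
Proof.
move=> sF; apply: (smooth_on_eq (F := fun x => -1 * F x)).
  by move=> x _; rewrite mulN1r.
by apply: smooth_onM => //; exact: smooth_on_cst.
Qed.

Lemma smooth_onB F G : smooth_on U F -> smooth_on U G ->
  smooth_on U (fun x => F x - G x).
Proof. by move=> sF sG; apply: smooth_onD => //; exact: smooth_onN. Qed.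

Lemma smooth_onX2 F : smooth_on U F -> smooth_on U (fun x => F x ^+ 2).
Proof. by move=> sF; exact: smooth_onM. Qed.

Lemma smooth_on_div F G : (forall x, U x -> G x != 0) ->
  smooth_on U F -> smooth_on U G -> smooth_on U (fun x => F x / G x).
Proof. by move=> G0 sF sG; apply: smooth_onM => //; exact: smooth_onV. Qed.

Lemma smooth_on_of_partial F (H : 'I_n.+1 -> 'rV[K]_n.+1 -> K) :
  (forall x, U x -> differentiable F x) -> (forall j, smooth_on U (H j)) ->
  (forall j x, U x -> partial j F x = H j x) -> smooth_on U F.
Proof.
move=> dF sH pF [|k]; first by move=> x Ux; exact/differentiable_continuous/dF.
by split=> // j; apply: Ck_on_eq (sH j k) => x Ux; rewrite pF.
Qed.

(* The derivatives of an exponential or of a power involve the function itself,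
   so the order of smoothness is bootstrapped. *)
Lemma smooth_on_of_log_partial F (H : 'I_n.+1 -> 'rV[K]_n.+1 -> K) :
  (forall x, U x -> differentiable F x) -> (forall j, smooth_on U (H j)) ->
  (forall j x, U x -> partial j F x = F x * H j x) -> smooth_on U F.
Proof.
move=> dF sH pF; elim=> [|k IHk].
  by move=> x Ux; exact/differentiable_continuous/dF.
split=> // j; apply: (@Ck_on_eq _ (fun x => F x * H j x)); last exact: (Ck_onM IHk (sH j k)).
by move=> x Ux; rewrite pF.
Qed.

Lemma derive_coord j x v : 'D_v (fun y : 'rV[K]_n.+1 => y ord0 j) x = v ord0 j.
Proof.
rewrite deriveE; last exact: differentiable_coord.
have @f : {linear 'rV[K]_n.+1 -> K}.
  by exists (fun N : 'rV[K]_n.+1 => N ord0 j); do 2![eexists];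
     do ?[constructor]; rewrite ?mxE// => ? *; rewrite ?mxE//; move=> ?; rewrite !mxE.
rewrite -[LHS]/('d f x v) diff_lin//; exact: coord_continuous.
Qed.

Lemma smooth_on_coord j : smooth_on U (fun y => y ord0 j).
Proof.
apply: (@smooth_on_of_partial _ (fun l _ => (delta_mx ord0 l : 'rV[K]_n.+1) ord0 j)).
- by move=> x _; exact: differentiable_coord.
- by move=> l; exact: smooth_on_cst.
- by move=> l x _; exact: derive_coord.
Qed.

End Smoothness.

(** * The coadjoint vector fields *)

(** Differentiability makes the derivative linear in the direction; the double sum in
    [coadjoint_invariant] thereby becomes a single directional derivative. *)
Lemma derive_sum_partial (K : numFieldType) (n : nat) (F : 'rV[K]_n.+1 -> K) x v :
  differentiable F x -> 'D_v F x = \sum_j v ord0 j * partial j F x.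
Proof.
move=> dF; rewrite deriveE// [in LHS](row_sum_delta v) linear_sum.
by apply: eq_bigr => j _; rewrite linearZ /partial deriveE.
Qed.

Section CoadjointField.
Context {K : numFieldType} {g : vectType K}.

(** The functional x composed with ad e_i, which is the infinitesimal coadjoint action of e_i at x
    up to sign. *)
Definition coadjoint_field (n : nat) (br : g -> g -> g) (e : n.+1.-tuple g)
    (i : 'I_n.+1) (x : 'rV[K]_n.+1) : 'rV[K]_n.+1 :=
  \row_j \sum_k struct_const br e i j k * x ord0 k.

Lemma coadjoint_invariant_derive n (br : g -> g -> g) (e : n.+1.-tuple g) U F :
  domain U -> smooth_on U F ->
  (forall x, U x -> forall i, 'D_(coadjoint_field br e i x) F x = 0) ->
  coadjoint_invariant br e U F.
Proof.
move=> dU sF F0; split=> // x Ux i; rewrite -[RHS](F0 x Ux i).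
rewrite derive_sum_partial; last exact: smooth_on_differentiable sF _ Ux.
by apply: eq_bigr => j _; rewrite mxE mulr_suml.
Qed.

Lemma lie_bracketN (br : g -> g -> g) : is_lie_bracket br ->
  forall u v, br u v = - br v u.
Proof.
move=> [brl brr br0 _] u v; apply/eqP; rewrite -addr_eq0.
have := br0 (1 *: u + v); rewrite brl !brr !br0 !scale1r addr0 add0r addrC.
by rewrite addrC => ->.
Qed.

(** The multiple is -1 for e_n, by antisymmetry of the bracket, and 0 for the other e_i, whose
    brackets with e_1, ..., e_(n-1) vanish so that their fields move x_n alone. *)
Lemma coadjoint_field_almost_abelian N (br : g -> g -> g) (e : N.+1.-tuple g)
    (M : 'M[K]_N) : almost_abelian br e M ->
  forall i, exists c, forall x (k : 'I_N),
    coadjoint_field br e i x ord0 (widen_ord (leqnSn N) k) =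
    c * \sum_l x ord0 (widen_ord (leqnSn N) l) * M l k.
Proof.
move=> [lie be EE EEn] i.
have := ltn_ord i; rewrite ltnS leq_eqVlt => /orP[/eqP iN|iN].
  exists (-1) => x k; rewrite mxE mulN1r.
  have -> : i = ord_max by exact: val_inj.
  have sc m : struct_const br e ord_max (widen_ord (leqnSn N) k) m =
      - \sum_l M l k * (widen_ord (leqnSn N) l == m)%:R.
    rewrite /struct_const lie_bracketN// EEn linearN linear_sum; congr (- _).
    apply: eq_bigr => l _; rewrite linearZ /=; congr (_ * _).
    by rewrite (tnth_nth 0) (coord_free _ _ (basis_free be)).
  under eq_bigr do rewrite sc mulNr mulr_suml.
  rewrite sumrN exchange_big; congr (- _); apply: eq_bigr => l _.
  rewrite (bigD1 (widen_ord (leqnSn N) l)) //= eqxx mulr1 big1 ?addr0 1?mulrC//.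
  by move=> m /negPf mk; rewrite eq_sym mk mulr0 mul0r.
exists 0 => x k; rewrite mxE mul0r big1// => m _.
have -> : i = widen_ord (leqnSn N) (Ordinal iN) by exact: val_inj.
by rewrite /struct_const EE linear0 mul0r.
Qed.

End CoadjointField.

(** * The linear field x M on single blocks *)

Section BlockFlow.
Context {K : numFieldType} {s : nat} (b : 'I_s -> block K).
Notation N := (total_size b).
Notation X := (block_coord (b := b)).

Local Notation rank := (@tagnat.Rank s (fun k => bsize (b k))).

(** Reconciles two numberings: the offset [rho] with a 1-based position, and the [tagnat.Rank] by
    which [\mxdiag] orders its rows. *)
Lemma block_coordE i (p : 'I_(bsize (b i))) (x : 'rV[K]_N.+1) :
  X i p.+1 x = x ord0 (widen_ord (leqnSn N) (rank i p)).
Proof.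
rewrite /block_coord addnS /=; congr (x _ _); apply: val_inj.
have rankE : rank i p = (rho b i + p)%N :> nat.
  exact: tagnat.RankEsum.
rewrite -rankE.
by rewrite /= inordK//; exact: leqW (ltn_ord (rank i p)).
Qed.

(* [v = c * x M], read off block by block; the last coordinate of [v] is free. *)
Definition linear_flow (c : K) (x v : 'rV[K]_N.+1) : Prop :=
  forall i (p : 'I_(bsize (b i))),
    X i p.+1 v = c * \sum_(q < bsize (b i)) X i q.+1 x * block_matrix (b i) q p.

Lemma coadjoint_field_linear_flow (g : vectType K) (br : g -> g -> g)
    (e : N.+1.-tuple g) : almost_abelian br e (direct_sum b) ->
  forall i, exists c, forall x, linear_flow c x (coadjoint_field br e i x).
Proof.
move=> /coadjoint_field_almost_abelian aa i; have [c cP] := aa i.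
exists c => x j p; rewrite block_coordE cP; congr (c * _).
pose y : 'rV[K]_N := \row_l x ord0 (widen_ord (leqnSn N) l).
(* Cut into a row of blocks, [y] is multiplied block by block by the block diagonal matrix, so block
   j of the product sees only block j of x. *)
transitivity ((y *m direct_sum b) ord0 (rank j p)).
  by rewrite [RHS]mxE; apply: eq_bigr => l _; rewrite [in RHS]mxE.
rewrite -[y]submxrowK /direct_sum mul_mxrow_mxdiag.
transitivity (submxrow (\mxrow_i (submxrow y i *m block_matrix (b i))) j ord0 p).
  by rewrite [RHS]mxE.
rewrite mxrowK mxE; apply: eq_bigr => q _; congr (_ * _).
by rewrite block_coordE !mxE.
Qed.

(** From here on the Lie algebra is out of sight: an invariant has to be constant along every v that
    satisfies [linear_flow], whatever c is. *)
Lemma invariant_of_linear_flow (g : vectType K) (br : g -> g -> g)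
    (e : N.+1.-tuple g) U F : almost_abelian br e (direct_sum b) ->
  domain U -> smooth_on U F ->
  (forall c x v, U x -> linear_flow c x v -> 'D_v F x = 0) ->
  coadjoint_invariant br e U F.
Proof.
move=> aa dU sF F0; apply: coadjoint_invariant_derive => // x Ux i.
by have [c cP] := coadjoint_field_linear_flow aa i; exact: F0 (cP x).
Qed.

(** The blocks are upper triangular, so their first columns involve only the first rows, although
    the block size is a variable. *)
Lemma sum_ord_trunc m n (f : nat -> K) : (m <= n)%N ->
  (forall q, (m <= q)%N -> f q = 0) -> \sum_(q < n) f q = \sum_(q < m) f q.
Proof.
move=> mn f0; rewrite -(big_mkord predT f) (big_cat_nat (leq0n m) mn) /=.
rewrite [in X in _ + X]big_nat_cond [X in _ + X]big1 ?addr0 ?big_mkord//.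
by move=> q /andP[/andP[mq _] _]; exact: f0.
Qed.

Lemma minn4_double r : (0 < r)%N -> minn 4 r.*2 = 2 \/ minn 4 r.*2 = 4.
Proof.
by case: r => [|[|r]] // _; [left | right; apply/minn_idPl].
Qed.

Section Block.
Variables (i : 'I_s) (c : K) (x v : 'rV[K]_N.+1).
Hypothesis cxv : linear_flow c x v.

Lemma linear_flow_jordan1 r l : b i = Jordan r l -> (0 < r)%N ->
  X i 1 v = c * (l * X i 1 x).
Proof.
move=> Eb r0; have := @cxv i; rewrite Eb /= => /(_ (Ordinal r0)) /= ->.
congr (c * _).
under eq_bigr => q _ do rewrite mxE /=.
rewrite (@sum_ord_trunc 1 _ (fun q => X i q.+1 x * (if 0%N == q then l
  else if 0%N == q.+1 then 1 else 0))) // => [|[]// q _]; last by rewrite mulr0.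
by rewrite big_ord_recl big_ord0 /= addr0 mulrC.
Qed.

Lemma linear_flow_jordan2 r l : b i = Jordan r l -> (1 < r)%N ->
  X i 2 v = c * (l * X i 2 x + X i 1 x).
Proof.
move=> Eb r1; have := @cxv i; rewrite Eb /= => /(_ (Ordinal r1)) /= ->.
congr (c * _).
under eq_bigr => q _ do rewrite mxE /=.
rewrite (@sum_ord_trunc 2 _ (fun q => X i q.+1 x * (if 1%N == q then l
  else if 1%N == q.+1 then 1 else 0))) // => [|[|[]]// q _]; last by rewrite mulr0.
by rewrite !big_ord_recl big_ord0 /= addr0 mulr1 mulrC addrC.
Qed.

(** The first two block columns, with the 2 x 2 entries decoded by parity. The bound [minn 4 r.*2]
    treats r = 1, where only two rows exist, together with r >= 2. *)
Lemma linear_flow_real_jordan r mu nu p : b i = RealJordan r mu nu ->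
  (p < r.*2)%N -> (p < 4)%N ->
  X i p.+1 v = c * \sum_(q < minn 4 r.*2) X i q.+1 x *
    (if p./2 == q./2 then (if odd p == odd q then mu
                           else if odd q then - nu else nu)
     else if (p./2 == q./2.+1) && (odd p == odd q) then 1 else 0).
Proof.
move=> Eb pr p4; have := @cxv i; rewrite Eb /= => /(_ (Ordinal pr)) /= ->.
congr (c * _); pose f q := X i q.+1 x *
    (if p./2 == q./2 then (if odd p == odd q then mu
                           else if odd q then - nu else nu)
     else if (p./2 == q./2.+1) && (odd p == odd q) then 1 else 0).
transitivity (\sum_(q < r.*2) f q).
  apply: eq_bigr => q _; rewrite !mxE /= !modn2 /f; congr (_ * _).
  have ob (u w : bool) : ((inord u : 'I_2) == inord w) = (u == w).
    by rewrite -val_eqE /= !inordK; case: u; case: w.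
  rewrite !mxE !ob !inordK ?ltnS ?leq_b1 // [odd q == _]eq_sym.
  case: eqP => // _; first by case: (odd p); case: (odd q).
  by case: eqP => //= _; case: (odd p == odd q).
have [//|r4] := leqP r.*2 4; apply: sum_ord_trunc => [|q q4]; first exact: ltnW.
(* A row q >= 4 has block row at least 2, while p < 4 has block column at most 1: the entry lies
   below the block diagonal. *)
have p1 : (p./2 < 2)%N by case: p p4 {pr f} => [|[|[|[|]]]].
have q2 : (2 <= q./2)%N by exact: (half_leq q4).
have pq := leq_trans p1 q2.
by rewrite /f ltn_eqF// ltn_eqF ?mulr0// ltnW.
Qed.

Variables (r : nat) (mu nu : K).
Hypothesis Eb : b i = RealJordan r mu nu.

Lemma linear_flow_real1 : (0 < r)%N ->
  X i 1 v = c * (mu * X i 1 x - nu * X i 2 x).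
Proof.
move=> r0; rewrite (linear_flow_real_jordan Eb) ?double_gt0//.
have [->|->] := minn4_double r0; rewrite !big_ord_recl big_ord0 /=; ring.
Qed.

Lemma linear_flow_real2 : (0 < r)%N ->
  X i 2 v = c * (nu * X i 1 x + mu * X i 2 x).
Proof.
move=> r0; rewrite (linear_flow_real_jordan Eb) //; last by case: r r0.
have [->|->] := minn4_double r0; rewrite !big_ord_recl big_ord0 /=; ring.
Qed.

Lemma linear_flow_real3 : (1 < r)%N ->
  X i 3 v = c * (mu * X i 3 x - nu * X i 4 x + X i 1 x).
Proof.
move=> r1; rewrite (linear_flow_real_jordan Eb) //; last by case: r r1 => [|[]].
have -> : minn 4 r.*2 = 4 by apply/minn_idPl; case: r r1 => [|[]].
rewrite !big_ord_recl big_ord0 /=; ring.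
Qed.

Lemma linear_flow_real4 : (1 < r)%N ->
  X i 4 v = c * (nu * X i 3 x + mu * X i 4 x + X i 2 x).
Proof.
move=> r1; rewrite (linear_flow_real_jordan Eb) //; last by case: r r1 => [|[]].
have -> : minn 4 r.*2 = 4 by apply/minn_idPl; case: r r1 => [|[]].
rewrite !big_ord_recl big_ord0 /=; ring.
Qed.

End Block.
End BlockFlow.

(** * Invariants over an arbitrary field *)

Section IsDerivePointwise.
Context {K : numFieldType} {V : normedModType K}.
Variables (x v : V).
Implicit Types (F G : V -> K) (a b : K).

(** In this pointwise form the rules nest along the syntax of a candidate, and only an algebraic
    identity is left for [ring] or [field]. *)
Lemma is_derive_addf F G a b : is_derive x v F a -> is_derive x v G b ->
  is_derive x v (fun y => F y + G y) (a + b).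
Proof. by move=> HF HG; exact: is_deriveD. Qed.

Lemma is_derive_subf F G a b : is_derive x v F a -> is_derive x v G b ->
  is_derive x v (fun y => F y - G y) (a - b).
Proof. by move=> HF HG; exact: is_deriveB. Qed.

Lemma is_derive_mulf F G a b : is_derive x v F a -> is_derive x v G b ->
  is_derive x v (fun y => F y * G y) (F x * b + G x * a).
Proof. by move=> HF HG; exact: is_deriveM. Qed.

Lemma is_derive_mulcf (c : K) F a : is_derive x v F a ->
  is_derive x v (fun y => c * F y) (c * a).
Proof. by move=> HF; exact: is_deriveZ. Qed.

Lemma is_derive_divf F G a b :
  is_derive x v F a -> is_derive x v G b -> G x != 0 ->
  is_derive x v (fun y => F y / G y) (F x * (- (G x) ^- 2 * b) + (G x)^-1 * a).
Proof.
move=> HF [dG <-] G0; apply: is_derive_mulf => //.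
by apply: DeriveDef; [exact: derivableV|exact: deriveV].
Qed.

Lemma is_derive_comp1 (phi : K -> K) F a b : differentiable F x ->
  is_derive (F x) 1 phi b -> is_derive x v F a ->
  is_derive x v (fun y => phi (F y)) (b * a).
Proof.
move=> dF dphi [_ <-]; apply: DeriveDef; last exact: derive_comp1.
by apply: diff_derivable; exact: (differentiable_comp1 dF dphi).
Qed.

Lemma is_derive_eq0 F a : is_derive x v F a -> a = 0 -> 'D_v F x = 0.
Proof. by case=> _ <-. Qed.

End IsDerivePointwise.

Section SmoothComposition.
Context {K : numFieldType} {n : nat} (U : set 'rV[K]_n.+1).
Hypothesis oU : open U.
Implicit Types (F f p : 'rV[K]_n.+1 -> K).

Lemma smooth_on_exp (E : K -> K) F : (forall z : K, is_derive z 1 E (E z)) ->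
  smooth_on U F -> smooth_on U (fun x => E (F x)).
Proof.
move=> dE sF; have dF := smooth_on_differentiable sF.
apply: (@smooth_on_of_log_partial _ _ _ oU _ (fun j => partial j F)).
- by move=> x Ux; exact: differentiable_comp1 (dF x Ux) (dE _).
- by move=> j; exact: smooth_on_partial.
- by move=> j x Ux; exact: derive_comp1 (dF x Ux) (dE _).
Qed.

(** The logarithmic derivative is the common interface of real and complex branches; it is smooth
    because f is smooth and does not vanish. *)
Lemma smooth_on_power (a : K) f p : (forall x, U x -> f x != 0) ->
  smooth_on U f -> (forall x, U x -> differentiable p x) ->
  (forall x v, U x -> 'D_v p x = p x * (a / f x * 'D_v f x)) -> smooth_on U p.
Proof.
move=> f0 sf dp Dp.
apply: (@smooth_on_of_log_partial _ _ _ oU _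
  (fun j x => a / f x * partial j f x)) => //.
- move=> j; apply: smooth_onM => //; last exact: smooth_on_partial.
  by apply: smooth_on_div => //; exact: smooth_on_cst.
- by move=> j x Ux; exact: Dp.
Qed.

End SmoothComposition.

Section Invariants.
Context {K : numFieldType} {s : nat} (b : 'I_s -> block K).
Notation N := (total_size b).
Notation X := (block_coord (b := b)).
Variables (g : vectType K) (br : g -> g -> g) (e : N.+1.-tuple g).
Hypothesis aa : almost_abelian br e (direct_sum b).
Variable U : set 'rV[K]_N.+1.
Hypothesis dU : domain U.
Variables i j : 'I_s.
Notation inv := (coadjoint_invariant br e U).

Let oU : open U. Proof. by case: dU. Qed.

Lemma smooth_on_block_coord k m : smooth_on U (X k m).
Proof. exact: smooth_on_coord. Qed.

Lemma differentiable_block_coord k m x : differentiable (X k m) x.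
Proof. exact: differentiable_coord. Qed.

Lemma is_derive_block_coord k m x v : is_derive x v (X k m) (X k m v).
Proof.
by apply: DeriveDef; [exact/diff_derivable/differentiable_block_coord
                     |exact: derive_coord].
Qed.

Local Notation sX := (smooth_on_block_coord _ _).
Local Notation dX := (is_derive_block_coord _ _ _ _).

Lemma invariant_power_product ri li rj lj (p q : 'rV[K]_N.+1 -> K) :
  b i = Jordan ri li -> b j = Jordan rj lj -> (0 < ri)%N -> (0 < rj)%N ->
  (forall x, U x -> X i 1 x != 0 /\ X j 1 x != 0) ->
  (forall x, U x -> differentiable p x /\ differentiable q x) ->
  (forall x v, U x -> 'D_v p x = p x * (- lj / X i 1 x * 'D_v (X i 1) x)) ->
  (forall x v, U x -> 'D_v q x = q x * (li / X j 1 x * 'D_v (X j 1) x)) ->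
  inv (fun x => p x * q x).
Proof.
move=> bi bj ri0 rj0 X0 dpq Dp Dq.
apply: (invariant_of_linear_flow aa dU) => [|c x v Ux cxv].
  apply: smooth_onM => //.
    apply: (smooth_on_power oU _ _ _ Dp) => [x /X0[]//||x /dpq[]//]; exact: sX.
  apply: (smooth_on_power oU _ _ _ Dq) => [x /X0[]//||x /dpq[]//]; exact: sX.
have [X1 X2] := X0 x Ux; have [dp dq] := dpq x Ux.
rewrite [LHS]deriveM ?Dp ?Dq//; try exact: diff_derivable.
have [_ ->] := is_derive_block_coord i 1 x v.
have [_ ->] := is_derive_block_coord j 1 x v.
rewrite (linear_flow_jordan1 cxv bi ri0) (linear_flow_jordan1 cxv bj rj0).
rewrite /GRing.scale /=; field.
by rewrite X1 X2.
Qed.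

(** This is the difference of the quotients x_2 / x_1 cleared of denominators. With eigenvalue 0 the
    denominators are themselves constant along the flow, so the zeros of x_1 may lie in U. *)
Lemma invariant_nilpotent_pair ri rj :
  b i = Jordan ri 0 -> b j = Jordan rj 0 -> (1 < ri)%N -> (1 < rj)%N ->
  inv (fun x => X j 2 x * X i 1 x - X i 2 x * X j 1 x).
Proof.
move=> bi bj ri1 rj1.
apply: (invariant_of_linear_flow aa dU) => [|c x v Ux cxv].
  apply: smooth_onB => //; apply: smooth_onM => //; exact: sX.
apply: is_derive_eq0 (is_derive_subf (is_derive_mulf dX dX)
  (is_derive_mulf dX dX)) _.
rewrite (linear_flow_jordan1 cxv bi (ltnW ri1)).
rewrite (linear_flow_jordan1 cxv bj (ltnW rj1)).
rewrite (linear_flow_jordan2 cxv bi ri1) (linear_flow_jordan2 cxv bj rj1).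
by ring.
Qed.

(* Both quotients grow at unit speed along the flow, whatever the eigenvalues. *)
Lemma invariant_jordan_jordan_quotient ri li rj lj :
  b i = Jordan ri li -> b j = Jordan rj lj -> (1 < ri)%N -> (1 < rj)%N ->
  (forall x, U x -> X j 1 x != 0 /\ X i 1 x != 0) ->
  inv (fun x => X j 2 x / X j 1 x - X i 2 x / X i 1 x).
Proof.
move=> bi bj ri1 rj1 X0.
apply: (invariant_of_linear_flow aa dU) => [|c x v Ux cxv].
  apply: smooth_onB => //; apply: smooth_on_div => //; try exact: sX;
    by move=> x /X0[].
have [X1 X2] := X0 x Ux.
apply: is_derive_eq0 (is_derive_subf (is_derive_divf dX dX X1)
  (is_derive_divf dX dX X2)) _.
rewrite (linear_flow_jordan1 cxv bi (ltnW ri1)).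
rewrite (linear_flow_jordan1 cxv bj (ltnW rj1)).
rewrite (linear_flow_jordan2 cxv bi ri1) (linear_flow_jordan2 cxv bj rj1).
by field; rewrite X1 X2.
Qed.

(** E stands for [expR] or [cexp]. Its argument decreases at rate li, which offsets the growth rate
    li of [X i 1]. *)
Lemma invariant_jordan_jordan_exp (E : K -> K) ri li rj :
  (forall z : K, is_derive z 1 E (E z)) ->
  b i = Jordan ri li -> b j = Jordan rj 0 -> (0 < ri)%N -> (1 < rj)%N ->
  (forall x, U x -> X j 1 x != 0) ->
  inv (fun x => X i 1 x * E (- li * (X j 2 x / X j 1 x))).
Proof.
move=> dE bi bj ri0 rj1 X0.
have sQ : smooth_on U (fun x => - li * (X j 2 x / X j 1 x)).
  apply: smooth_onM => //; first exact: smooth_on_cst.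
  by apply: smooth_on_div => //; exact: sX.
apply: (invariant_of_linear_flow aa dU) => [|c x v Ux cxv].
  by apply: smooth_onM => //; [exact: sX|exact: smooth_on_exp].
have X1 := X0 x Ux.
apply: is_derive_eq0 (is_derive_mulf dX (is_derive_comp1
  (smooth_on_differentiable sQ Ux) (dE _)
  (is_derive_mulcf _ (is_derive_divf dX dX X1)))) _.
rewrite (linear_flow_jordan1 cxv bi ri0).
rewrite (linear_flow_jordan1 cxv bj (ltnW rj1)) (linear_flow_jordan2 cxv bj rj1).
by field.
Qed.

(* With z_1 = x_1 + i x_2 and z_2 = x_3 + i x_4 this is Re (z_2 / z_1), the
   counterpart of the quotient x_2 / x_1 of a Jordan block. *)
Definition real_jordan_quotient (k : 'I_s) (x : 'rV[K]_N.+1) : K :=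
  (X k 1 x * X k 3 x + X k 2 x * X k 4 x) / (X k 1 x ^+ 2 + X k 2 x ^+ 2).

Lemma smooth_on_real_jordan_quotient k :
  (forall x, U x -> X k 1 x ^+ 2 + X k 2 x ^+ 2 != 0) ->
  smooth_on U (real_jordan_quotient k).
Proof.
move=> X0; apply: smooth_on_div => //.
  by apply: smooth_onD => //; apply: smooth_onM => //; exact: sX.
by apply: smooth_onD => //; apply: smooth_onX2 => //; exact: sX.
Qed.

Lemma is_derive_real_jordan_quotient k r mu nu c x v :
  linear_flow c x v -> b k = RealJordan r mu nu -> (1 < r)%N ->
  X k 1 x ^+ 2 + X k 2 x ^+ 2 != 0 ->
  is_derive x v (real_jordan_quotient k) c.
Proof.
move=> cxv bk r1 X0.
have dX2 m : is_derive x v (fun y => X k m y ^+ 2) (2 * X k m x * X k m v).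
  rewrite -mulrA mulr_natl mulr2n.
  by apply: is_derive_mulf; exact: dX.
have dN : is_derive x v (fun y => X k 1 y * X k 3 y + X k 2 y * X k 4 y) _ :=
  is_derive_addf (is_derive_mulf dX dX) (is_derive_mulf dX dX).
have dQ := is_derive_divf dN (is_derive_addf (dX2 1%N) (dX2 2%N)) X0.
apply: is_derive_eq dQ _.
rewrite (linear_flow_real1 cxv bk (ltnW r1)) (linear_flow_real2 cxv bk (ltnW r1)).
rewrite (linear_flow_real3 cxv bk r1) (linear_flow_real4 cxv bk r1).
by field.
Qed.

Lemma invariant_jordan_real_quotient ri li rj muj nuj :
  b i = Jordan ri li -> b j = RealJordan rj muj nuj ->
  (1 < ri)%N -> (1 < rj)%N ->
  (forall x, U x -> X j 1 x ^+ 2 + X j 2 x ^+ 2 != 0 /\ X i 1 x != 0) ->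
  inv (fun x => real_jordan_quotient j x - X i 2 x / X i 1 x).
Proof.
move=> bi bj ri1 rj1 X0.
apply: (invariant_of_linear_flow aa dU) => [|c x v Ux cxv].
  apply: smooth_onB => //.
    by apply: smooth_on_real_jordan_quotient => x /X0[].
  by apply: smooth_on_div => //; [move=> x /X0[]|exact: sX|exact: sX].
have [X1 X2] := X0 x Ux.
apply: is_derive_eq0 (is_derive_subf
  (is_derive_real_jordan_quotient cxv bj rj1 X1) (is_derive_divf dX dX X2)) _.
rewrite (linear_flow_jordan1 cxv bi (ltnW ri1)) (linear_flow_jordan2 cxv bi ri1).
by field.
Qed.

Lemma invariant_real_real_quotient ri mui nui rj muj nuj :
  b i = RealJordan ri mui nui -> b j = RealJordan rj muj nuj ->
  (1 < ri)%N -> (1 < rj)%N ->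
  (forall x, U x -> X j 1 x ^+ 2 + X j 2 x ^+ 2 != 0
                    /\ X i 1 x ^+ 2 + X i 2 x ^+ 2 != 0) ->
  inv (fun x => real_jordan_quotient j x - real_jordan_quotient i x).
Proof.
move=> bi bj ri1 rj1 X0.
apply: (invariant_of_linear_flow aa dU) => [|c x v Ux cxv].
  by apply: smooth_onB => //; apply: smooth_on_real_jordan_quotient => x /X0[].
have [X1 X2] := X0 x Ux.
apply: is_derive_eq0 (is_derive_subf
  (is_derive_real_jordan_quotient cxv bj rj1 X1)
  (is_derive_real_jordan_quotient cxv bi ri1 X2)) _.
by rewrite subrr.
Qed.

End Invariants.

(** * Real arctangents and powers *)

Section RealInvariants.
Context {R : realType} {s : nat} (b : 'I_s -> block R).
Notation N := (total_size b).
Notation X := (block_coord (b := b)).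
Variables (g : vectType R) (br : g -> g -> g) (e : N.+1.-tuple g).
Hypothesis aa : almost_abelian br e (direct_sum b).
Variable U : set 'rV[R]_N.+1.
Hypothesis dU : domain U.
Variables i j : 'I_s.
Notation inv := (coadjoint_invariant br e U).

Let oU : open U. Proof. by case: dU. Qed.

Lemma sumr_sqr_neq0 (u w : R) : u != 0 -> u ^+ 2 + w ^+ 2 != 0.
Proof.
by move=> u0; rewrite gt_eqF// ltr_pwDl ?sqr_ge0// exprn_even_gt0.
Qed.

(** An argument of z_1 up to a multiple of pi that is constant where x_1 keeps its sign, hence with
    the same derivative. *)
Definition real_jordan_angle (k : 'I_s) (x : 'rV[R]_N.+1) : R :=
  atan (X k 2 x / X k 1 x).

Lemma smooth_on_atan (F : 'rV[R]_N.+1 -> R) :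
  smooth_on U F -> smooth_on U (fun x => atan (F x)).
Proof.
move=> sF; have dF := smooth_on_differentiable sF.
apply: (@smooth_on_of_partial _ _ _ oU _
  (fun l x => (1 + F x ^+ 2)^-1 * partial l F x)).
- by move=> x Ux; exact: differentiable_comp1 (dF x Ux) (is_derive1_atan _).
- move=> l; apply: smooth_onM => //; last exact: smooth_on_partial.
  apply: smooth_onV => // [x _|].
    by rewrite -(expr1n _ 2) sumr_sqr_neq0// oner_neq0.
  by apply: smooth_onD => //; [exact: smooth_on_cst|exact: smooth_onX2].
- by move=> l x Ux; exact: derive_comp1 (dF x Ux) (is_derive1_atan _).
Qed.

Lemma smooth_on_real_jordan_angle k : (forall x, U x -> X k 1 x != 0) ->
  smooth_on U (real_jordan_angle k).
Proof.
move=> X0; apply: smooth_on_atan; apply: smooth_on_div => //;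
  exact: smooth_on_block_coord.
Qed.

Lemma is_derive_real_jordan_angle k r mu nu c x v :
  linear_flow c x v -> b k = RealJordan r mu nu -> (0 < r)%N ->
  X k 1 x != 0 -> is_derive x v (real_jordan_angle k) (c * nu).
Proof.
move=> cxv bk r0 X0.
have dX m := is_derive_block_coord (b := b) k m x v.
have dQ := is_derive_divf (dX 2%N) (dX 1%N) X0.
have diffQ : differentiable (fun y => X k 2 y / X k 1 y) x.
  apply: differentiableM; first exact: differentiable_block_coord.
  by apply: differentiableV => //; exact: differentiable_block_coord.
apply: is_derive_eq (is_derive_comp1 diffQ (is_derive1_atan _) dQ) _.
rewrite (linear_flow_real1 cxv bk r0) (linear_flow_real2 cxv bk r0).
by field; rewrite X0 sumr_sqr_neq0.
Qed.

Lemma invariant_jordan_real_exp ri li rj muj nuj :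
  b i = Jordan ri li -> b j = RealJordan rj muj nuj ->
  (0 < ri)%N -> (0 < rj)%N -> nuj != 0 ->
  (forall x, U x -> X j 1 x != 0) ->
  inv (fun x => X i 1 x * expR (- (li / nuj) * real_jordan_angle j x)).
Proof.
move=> bi bj ri0 rj0 nu0 X0.
have sA : smooth_on U (fun x => - (li / nuj) * real_jordan_angle j x).
  apply: smooth_onM => //; first exact: smooth_on_cst.
  exact: smooth_on_real_jordan_angle.
apply: (invariant_of_linear_flow aa dU) => [|c x v Ux cxv].
  apply: smooth_onM => //; first exact: smooth_on_block_coord.
  by apply: smooth_on_exp => // z; exact: is_derive_expR.
apply: is_derive_eq0 (is_derive_mulf (is_derive_block_coord i 1 x v)
  (is_derive_comp1 (smooth_on_differentiable sA Ux) (is_derive_expR _)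
  (is_derive_mulcf _ (is_derive_real_jordan_angle cxv bj rj0 (X0 x Ux))))) _.
rewrite (linear_flow_jordan1 cxv bi ri0).
by field.
Qed.

Lemma invariant_real_real_angle ri mui nui rj muj nuj :
  b i = RealJordan ri mui nui -> b j = RealJordan rj muj nuj ->
  (0 < ri)%N -> (0 < rj)%N ->
  (forall x, U x -> X j 1 x != 0 /\ X i 1 x != 0) ->
  inv (fun x => nui * real_jordan_angle j x - nuj * real_jordan_angle i x).
Proof.
move=> bi bj ri0 rj0 X0.
apply: (invariant_of_linear_flow aa dU) => [|c x v Ux cxv].
  by apply: smooth_onB => //; apply: smooth_onM => //;
    try exact: smooth_on_cst; apply: smooth_on_real_jordan_angle => x /X0[].
have [X1 X2] := X0 x Ux.
apply: is_derive_eq0 (is_derive_subf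
  (is_derive_mulcf _ (is_derive_real_jordan_angle cxv bj rj0 X1))
  (is_derive_mulcf _ (is_derive_real_jordan_angle cxv bi ri0 X2))) _.
by ring.
Qed.

End RealInvariants.

(** * Real powers of functions of either sign *)

Section RealPower.
Context {R : realType}.

Lemma is_derive_ln_norm (u : R) : u != 0 -> is_derive u 1 (fun t => ln `|t|) u^-1.
Proof.
rewrite neq_lt => /orP[u0|u0].
  apply: (@near_eq_is_derive _ _ _ (fun t : R => ln (- t))).
    by near=> t; rewrite ltr0_norm//; near: t; exact: lt_nbhsl.
  have Nu0 : 0 < - u by rewrite oppr_gt0.
  have dN : differentiable (-%R : R -> R) u by exact/derivable1_diffP.
  have H := is_derive_comp1 dN (is_derive1_ln Nu0) (is_deriveNid u (1 : R)).
  by apply: is_derive_eq H _; rewrite invrN mulrNN mulr1.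
apply: (@near_eq_is_derive _ _ _ (fun t : R => ln t)); last exact: is_derive1_ln.
by near=> t; rewrite gtr0_norm//; near: t; exact: lt_nbhsr.
Unshelve. all: by end_near. Qed.

Lemma is_derive_norm_powR (a u : R) : u != 0 ->
  is_derive u 1 (fun t => `|t| `^ a) (`|u| `^ a * (a / u)).
Proof.
move=> u0.
(* [powR] has a separate value at 0, so the exponential formula is used only for t != 0. *)
have powE (t : R) : t != 0 -> `|t| `^ a = expR (a * ln `|t|).
  by move=> t0; rewrite /powR normr_eq0 (negPf t0).
have dl := is_derive_ln_norm u0.
have dal := is_derive_mulcf a dl.
have diffal : differentiable (fun t : R => a * ln `|t|) u.
  by apply/derivable1_diffP; case: dal.
apply: (@near_eq_is_derive _ _ _ (fun t : R => expR (a * ln `|t|))).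
  near=> t; rewrite powE//; near: t.
  by apply: (@cvgr_neq0 _ _ _ _ _ id u).
by apply: is_derive_eq (is_derive_comp1 diffal (is_derive_expR _) dal) _;
  rewrite powE.
Unshelve. all: by end_near. Qed.

(** The sign is one constant on all of U and factors out; the derivative of |t|^a is |t|^a a / t for
    t of either sign. *)
Lemma real_power_branch_derive n (U : set 'rV[R]_n.+1) f (a : R) p :
  open U -> (forall x, U x -> differentiable f x) ->
  real_power_branch U f a p ->
  (forall x, U x -> differentiable p x) /\
  (forall x v, U x -> 'D_v p x = p x * (a / f x * 'D_v f x)).
Proof.
move=> oU df [sgn fp].
have pE x : U x -> (-1) ^+ sgn * `|f x| `^ a = p x by move=> /fp[].
have dphi x (Ux : U x) :
    is_derive (f x) 1 (fun t => (-1) ^+ sgn * `|t| `^ a) (p x * (a / f x)).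
  have [f0 _] := fp x Ux.
  apply: is_derive_eq (is_derive_mulcf _ (is_derive_norm_powR a f0)) _.
  by rewrite -pE//; exact: mulrA.
split=> [x Ux|x v Ux].
  apply: near_eq_differentiable (differentiable_comp1 (df x Ux) (dphi x Ux)).
  exact: (near_open_eq oU pE Ux).
rewrite -(near_eq_derive v (near_open_eq oU pE Ux)).
rewrite (derive_comp1 v (df x Ux) (dphi x Ux)). exact/esym/mulrA.
Qed.

End RealPower.

(** * The complex exponential and complex powers *)

Section Slope.
Context {K : numFieldType}.
Implicit Types (phi : K -> K) (z d : K).

Lemma is_derive1_near phi z d : is_derive z 1 phi d -> forall e, 0 < e ->
  \forall h \near (0 : K), `|phi (z + h) - phi z - d * h| <= e * `|h|.
Proof.
move=> [dphi <-] e e0; have /eqaddoP/(_ _ e0) := derivable_nbhs dphi.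
apply: filterS => h /=; congr (_ <= _).
rewrite /= -[(_ - _) h]/(_ - (phi z + h *: 'D_1 phi z)).
by rewrite /= /GRing.scale /= mulr1 opprD addrA [h + z]addrC [h * _]mulrC.
Qed.

Lemma near_is_derive1 phi z d :
  (forall e, 0 < e ->
    \forall h \near (0 : K), `|phi (z + h) - phi z - d * h| <= e * `|h|) ->
  is_derive z 1 phi d.
Proof.
move=> H.
have cd : (fun h : K => h^-1 *: ((phi \o shift z) (h *: (1 : K)) - phi z)) @ 0^' --> d.
  apply/cvgrPdist_le => e e0; have He := H _ e0.
  near=> h.
  have h0 : h != 0 by near: h; exact: nbhs_dnbhs_neq.
  rewrite /= /GRing.scale /= mulr1 [h + z]addrC.
  have -> : d - h^-1 * (phi (z + h) - phi z) =
    - (h^-1 * (phi (z + h) - phi z - d * h)) by field.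
  rewrite normrN normrM normfV ler_pdivrMl ?normr_gt0// [leRHS]mulrC.
  by near: h; apply: nbhs_dnbhs.
by apply: DeriveDef; [apply/cvg_ex; exists d|exact: cvg_lim].
Unshelve. all: by end_near. Qed.

(** The difference quotient of Carathéodory, completed at z by the derivative so that it is
    continuous there. *)
Definition slope phi z d (w : K) : K :=
  if w == z then d else (phi w - phi z) / (w - z).

Lemma slope_continuous phi z d : is_derive z 1 phi d ->
  {for z, continuous (slope phi z d)}.
Proof.
move=> dphi; change (slope phi z d w @[w --> z] --> slope phi z d z).
apply/(cvgrPdist_le (F := nbhs z)) => e e0.
have H := is_derive1_near dphi e0.
have {}H : \forall w \near z, `|phi w - phi z - d * (w - z)| <= e * `|w - z|.
  rewrite (near_shift 0) subr0; apply: filterS H => h /=.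
  by rewrite [h + z]addrC [z + h - z]addrAC subrr add0r.
near=> w; rewrite /slope eqxx; case: eqVneq => [_|wz].
  by rewrite subrr normr0 ltW.
have wz0 : w - z != 0 by rewrite subr_eq0.
have -> : d - (phi w - phi z) / (w - z) =
  - ((phi w - phi z - d * (w - z)) / (w - z)) by field.
rewrite normrN normrM normfV ler_pdivrMr ?normr_gt0//.
by near: w.
Unshelve. all: by end_near. Qed.

(* An inverse function theorem without the theorem: a continuous local inverse
   of [phi] is differentiable where phi' does not vanish. *)
Lemma differentiable_lift (V : normedModType K) phi (L f : V -> K) x d :
  is_derive (L x) 1 phi d -> d != 0 -> {for x, continuous L} ->
  differentiable f x -> (\forall y \near x, phi (L y) = f y) ->
  is_diff x L (d^-1 \*: 'd f x).
Proof.
move=> dphi d0 cL df Lf.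
have cs : {for x, continuous (fun y => slope phi (L x) d (L y))}.
  exact: (continuous_comp cL (slope_continuous dphi)).
have sx : slope phi (L x) d (L x) = d by rewrite /slope eqxx.
(* Since f = phi o L near x, the increment of L is that of f divided by the slope of phi: the
   criterion applies with factor G. *)
pose G y := (slope phi (L x) d (L y))^-1.
have -> : d^-1 = G x by rewrite /G sx.
apply: caratheodory_is_diff => //.
  by apply: continuousV; rewrite ?sx.
have s0 : \forall y \near x, slope phi (L x) d (L y) != 0.
  by apply: (cvgr_neq0 d) => //; rewrite -[X in _ --> X]sx.
have Lfx := nbhs_singleton Lf.
near=> y; rewrite -(near Lf y)// -Lfx /G.
have : slope phi (L x) d (L y) != 0 by near: y.
rewrite /slope; case: (eqVneq (L y) (L x)) => [->|Lxy]; first by rewrite !subrr mulr0.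
rewrite mulf_eq0 invr_eq0 negb_or => /andP[p0 Lxy0].
by rewrite invf_div divfK.
Unshelve. all: by end_near. Qed.

Lemma exp_power_derive (E : K -> K) (dE : forall z : K, is_derive z 1 E (E z))
    (E0 : forall z, E z != 0) n (U : set 'rV[K]_n.+1) (f p : 'rV[K]_n.+1 -> K) a :
  open U -> (forall x, U x -> differentiable f x) ->
  (exists L : 'rV[K]_n.+1 -> K, continuous_on U L /\
    (forall x, U x -> E (L x) = f x /\ p x = E (a * L x))) ->
  [/\ forall x, U x -> f x != 0,
      forall x, U x -> differentiable p x
    & forall x v, U x -> 'D_v p x = p x * (a / f x * 'D_v f x)].
Proof.
move=> oU df [L [cL Lfp]].
have Lf x : U x -> E (L x) = f x by move=> /Lfp[].
have pE x : U x -> E (a * L x) = p x by move=> /Lfp[_ ->].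
have f0 x : U x -> f x != 0 by move=> Ux; rewrite -Lf// E0.
have dL x : U x -> is_diff x L ((f x)^-1 \*: 'd f x).
  move=> Ux; apply: (differentiable_lift (phi := E)).
  - by rewrite -Lf//; exact: dE.
  - exact: f0.
  - exact: cL.
  - exact: df.
  - exact: (near_open_eq oU Lf Ux).
have daL x : U x -> differentiable (fun y => a * L y) x.
  by move=> /dL[dLx _]; exact: differentiableM.
split=> // [x Ux|x v Ux].
  apply: near_eq_differentiable (near_open_eq oU pE Ux) _.
  exact: differentiable_comp1 (daL x Ux) (dE _).
have [dLx dLE] := dL x Ux.
rewrite -(near_eq_derive v (near_open_eq oU pE Ux)).
rewrite (derive_comp1 v (daL x Ux) (dE _)) pE//; congr (_ * _).
have [_ ->] := is_derive_mulcf a (derivableP (diff_derivable (v := v) dLx)).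
rewrite (deriveE v dLx) (deriveE v (df x Ux)) dLE.
exact: mulrA.
Qed.

End Slope.

(** * Complex differentiability of the exponential *)

Section ComplexExp.
Context {R : realType}.
Local Open Scope complex_scope.
Local Notation C := (R[i] : numFieldType).
Implicit Types (z w h : C).

Lemma cexpD z w : cexp (z + w) = cexp z * cexp w.
Proof.
case: z w => [a b] [c d]; rewrite /cexp /= expRD sinD cosD.
by apply/eqP; rewrite eq_complex /=; apply/andP; split; apply/eqP; ring.
Qed.

Lemma cexp0 : cexp (0 : C) = 1.
Proof. by rewrite /cexp /= expR0 cos0 sin0 mulr0 mulr1. Qed.

Lemma cexp_neq0 z : cexp z != 0.
Proof.
apply/eqP => z0; have /eqP := cexpD z (- z).
by rewrite subrr cexp0 z0 mul0r oner_eq0.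
Qed.

Lemma normc_real (a : R) : `|a%:C| = `|a|%:C.
Proof. by rewrite normc_def /= expr0n addr0 sqrtr_sqr. Qed.

Lemma normc_le_add (a b : R) : `|a +i* b| <= (`|a| + `|b|)%:C.
Proof.
have -> : a +i* b = a%:C + 'i * b%:C.
  by apply/eqP; rewrite eq_complex /=; apply/andP; split; apply/eqP; ring.
rewrite (le_trans (ler_normD _ _))// normrM !normc_real.
have -> : `|'i : R[i]| = 1.
  by rewrite normc_def /= expr0n add0r expr1n sqrtr1.
by rewrite mul1r rmorphD.
Qed.

Lemma normc_ge_Im z : `|complex.Im z|%:C <= `|z|.
Proof.
rewrite normc_def lecR -sqrtr_sqr ler_wsqrtr// lerDr sqr_ge0//.
Qed.

Lemma near0_Re_Im (P : R -> Prop) : (\forall t \near (0 : R), P t) ->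
  \forall h \near (0 : C), P (complex.Re h) /\ P (complex.Im h).
Proof.
move=> /nbhs_normP[d /= d0 dP]; apply/nbhs_normP.
exists d%:C => /=; first by rewrite ltcR.
move=> h /=; rewrite sub0r normrN => hd.
by split; apply: dP => /=; rewrite sub0r normrN -ltcR;
  apply: le_lt_trans hd; [exact: normc_ge_Re|exact: normc_ge_Im].
Qed.

(** With |e^a| <= 2 the real part is at most 2d|b| + d|a| and the imaginary part at most 2d|b| +
    d|b|. The sum 5d|b| + d|a| gives the constant 6, as |a| and |b| are bounded by the modulus. *)
Lemma cexp_remainder_le (d a b : R) : 0 <= d ->
  `|expR a - 1 - a| <= d * `|a| -> `|expR a - 1| <= d -> `|expR a - 1| <= 1 ->
  `|cos b - 1| <= d * `|b| -> `|sin b - b| <= d * `|b| ->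
  `|cexp (a +i* b) - 1 - (a +i* b)| <= (6 * d)%:C * `|a +i* b|.
Proof.
move=> d0 expa expd exp1 cosb sinb.
have exp2 : `|expR a| <= 2.
  have -> : expR a = 1 + (expR a - 1) by ring.
  by rewrite (le_trans (ler_normD _ _))// normr1 lerD.
have -> : cexp (a +i* b) - 1 - (a +i* b) =
    (expR a * (cos b - 1) + (expR a - 1 - a)) +i*
    (expR a * (sin b - b) + (expR a - 1) * b).
  by apply/eqP; rewrite eq_complex /=; apply/andP; split; apply/eqP; ring.
apply: (le_trans (normc_le_add _ _)).
have H : `|expR a * (cos b - 1) + (expR a - 1 - a)| +
    `|expR a * (sin b - b) + (expR a - 1) * b|
    <= 5 * d * `|b| + d * `|a|.
  have H1 : `|expR a * (cos b - 1) + (expR a - 1 - a)|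
      <= 2 * (d * `|b|) + d * `|a|.
    by rewrite (le_trans (ler_normD _ _))// lerD// normrM ler_pM.
  have H2 : `|expR a * (sin b - b) + (expR a - 1) * b|
      <= 2 * (d * `|b|) + d * `|b|.
    by rewrite (le_trans (ler_normD _ _))// lerD// normrM ler_pM.
  by apply: (le_trans (lerD H1 H2)); lra.
apply: (@le_trans _ _ ((5 * d)%:C * `|b|%:C + d%:C * `|a|%:C)).
  by rewrite -!rmorphM -rmorphD lecR.
have -> : 6 * d = 5 * d + d by ring.
rewrite [(_ + d)%:C]rmorphD (mulrDl (5 * d)%:C); apply: lerD.
  apply: (ler_wpM2l _ (normc_ge_Im (a +i* b))).
  by rewrite ler0c mulr_ge0.
apply: (ler_wpM2l _ (normc_ge_Re (a +i* b))).
by rewrite ler0c.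
Qed.

Lemma is_derive_cexp0 : is_derive (0 : C) 1 (@cexp R : C -> C) 1.
Proof.
apply: near_is_derive1 => e e0.
(* A positive element of R[i] is real, so the tolerance can be handed to the real estimates, divided
   by the 6 of [cexp_remainder_le]. *)
have eE : e = (complex.Re e)%:C by rewrite RRe_real// gtr0_real.
have e0' : 0 < complex.Re e by rewrite -ltcR -eE.
pose d := complex.Re e / 6.
have d0 : 0 < d by rewrite divr_gt0.
have c0 : expR t @[t --> (0 : R)] --> (1 : R).
  by rewrite -[X in _ --> X](@expR0 R); exact: continuous_expR.
have near_exp (r : R) : 0 < r -> \forall t \near (0 : R), `|expR t - 1| <= r.
  move=> r0; move/cvgrPdist_le : c0 => /(_ _ r0).
  by apply: filterS => t; rewrite distrC.
have near_exp1 : \forall t \near (0 : R), `|expR t - 1 - t| <= d * `|t|.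
  apply: filterS (is_derive1_near (is_derive_expR (0 : R)) d0) => t.
  by rewrite add0r expR0 mul1r.
have near_sin : \forall t \near (0 : R), `|sin t - t| <= d * `|t|.
  apply: filterS (is_derive1_near (is_derive_sin (0 : R)) d0) => t.
  by rewrite add0r sin0 cos0 mul1r subr0.
have near_cos : \forall t \near (0 : R), `|cos t - 1| <= d * `|t|.
  apply: filterS (is_derive1_near (is_derive_cos (0 : R)) d0) => t.
  by rewrite add0r sin0 cos0 oppr0 mul0r subr0.
have nearP : \forall t \near (0 : R), [/\ `|expR t - 1 - t| <= d * `|t|,
    `|expR t - 1| <= d, `|expR t - 1| <= 1, `|cos t - 1| <= d * `|t|
    & `|sin t - t| <= d * `|t|].
  by near=> t; split; near: t => //; exact: near_exp.
apply: filterS (near0_Re_Im nearP) => -[a b] /= [[e1 e2 e3 _ _] [_ _ _ e4 e5]].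
rewrite add0r cexp0 mul1r eE -[complex.Re e](@divfK _ 6)// [_ / 6 * 6]mulrC.
exact: cexp_remainder_le (ltW d0) e1 e2 e3 e4 e5.
Unshelve. all: by end_near. Qed.

(** By multiplicativity the remainder at z is [cexp z] times the remainder at 0, so the tolerance is
    divided by its modulus. *)
Lemma is_derive_cexp z : is_derive z 1 (@cexp R : C -> C) (cexp z).
Proof.
apply: near_is_derive1 => e e0.
have z0 : 0 < `|cexp z| by rewrite normr_gt0 cexp_neq0.
have := is_derive1_near is_derive_cexp0 (divr_gt0 e0 z0).
apply: filterS => h; rewrite add0r cexp0 mul1r => H.
rewrite cexpD.
have -> : cexp z * cexp h - cexp z - cexp z * h = cexp z * (cexp h - 1 - h).
  by ring.
by rewrite normrM -ler_pdivlMl// mulrA [_^-1 * _]mulrC.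
Qed.

Lemma complex_power_branch_derive n (U : set 'rV[C]_n.+1)
    (f p : 'rV[C]_n.+1 -> C) (a : C) :
  open U -> (forall x, U x -> differentiable f x) ->
  complex_power_branch U f a p ->
  [/\ forall x, U x -> f x != 0,
      forall x, U x -> differentiable p x
    & forall x v, U x -> 'D_v p x = p x * (a / f x * 'D_v f x)].
Proof. exact: (exp_power_derive is_derive_cexp cexp_neq0). Qed.

End ComplexExp.

Theorem mainTheorem4 (R : realType) :
  (* F = R *)
  (forall (s : nat) (b : 'I_s -> block R) (g : vectType R) (br : g -> g -> g)
      (e : (total_size b).+1.-tuple g),
    (forall i, admissible (b i)) ->
    almost_abelian br e (direct_sum b) ->
    forall i j : 'I_s, i != j ->
    forall U : set 'rV[R]_(total_size b).+1, domain U ->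
    let X := block_coord (b := b) in
    let inv := coadjoint_invariant br e U in
    [/\ (* (A) *)
        forall (ri : nat) (li : R) (rj : nat) (lj : R),
          b i = Jordan ri li -> b j = Jordan rj lj ->
          [/\ li != 0 -> lj != 0 ->
                forall p q : 'rV[R]_(total_size b).+1 -> R,
                real_power_branch U (X i 1%N) (- lj) p ->
                real_power_branch U (X j 1%N) li q ->
                inv (fun x => p x * q x),
              (2 <= ri)%N -> li = 0 -> (2 <= rj)%N -> lj = 0 ->
                inv (fun x => X j 2%N x * X i 1%N x - X i 2%N x * X j 1%N x),
              (2 <= ri)%N -> li != 0 -> (2 <= rj)%N -> lj = 0 ->
                (forall x, U x -> X j 1%N x != 0 /\ X i 1%N x != 0) ->
                inv (fun x => X j 2%N x / X j 1%N x - X i 2%N x / X i 1%N x)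
            & ri = 1%N -> li != 0 -> (2 <= rj)%N -> lj = 0 ->
                (forall x, U x -> X j 1%N x != 0) ->
                inv (fun x =>
                  X i 1%N x * expR (- li * (X j 2%N x / X j 1%N x)))],
        (* (B) *)
        forall (ri : nat) (li : R) (rj : nat) (muj nuj : R),
          b i = Jordan ri li -> b j = RealJordan rj muj nuj ->
          ((2 <= ri)%N -> (2 <= rj)%N ->
             (forall x, U x ->
                X j 1%N x ^+ 2 + X j 2%N x ^+ 2 != 0 /\ X i 1%N x != 0) ->
             inv (fun x =>
               (X j 1%N x * X j 3%N x + X j 2%N x * X j 4%N x)
                 / (X j 1%N x ^+ 2 + X j 2%N x ^+ 2)
               - X i 2%N x / X i 1%N x))
          /\
          (ri = 1%N \/ rj = 1%N ->
             (forall x, U x -> X j 1%N x != 0) ->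
             inv (fun x =>
               X i 1%N x
                 * expR (- (li / nuj) * atan (X j 2%N x / X j 1%N x))))
      & (* (C) *)
        forall (ri : nat) (mui nui : R) (rj : nat) (muj nuj : R),
          b i = RealJordan ri mui nui -> b j = RealJordan rj muj nuj ->
          ((2 <= ri)%N -> (2 <= rj)%N ->
             (forall x, U x ->
                X j 1%N x ^+ 2 + X j 2%N x ^+ 2 != 0
                /\ X i 1%N x ^+ 2 + X i 2%N x ^+ 2 != 0) ->
             inv (fun x =>
               (X j 1%N x * X j 3%N x + X j 2%N x * X j 4%N x)
                 / (X j 1%N x ^+ 2 + X j 2%N x ^+ 2)
               - (X i 1%N x * X i 3%N x + X i 2%N x * X i 4%N x)
                 / (X i 1%N x ^+ 2 + X i 2%N x ^+ 2)))
          /\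
          (ri = 1%N \/ rj = 1%N ->
             (forall x, U x -> X j 1%N x != 0 /\ X i 1%N x != 0) ->
             inv (fun x =>
               nui * atan (X j 2%N x / X j 1%N x)
               - nuj * atan (X i 2%N x / X i 1%N x)))])
  /\
  (* F = C: only Jordan blocks occur *)
  (forall (s : nat) (r : 'I_s -> nat) (lam : 'I_s -> R[i]),
    let b := (fun i => Jordan (r i) (lam i)) in
    forall (g : vectType R[i]) (br : g -> g -> g)
      (e : (total_size b).+1.-tuple g),
    (forall i, admissible (b i)) ->
    almost_abelian br e (direct_sum b) ->
    forall i j : 'I_s, i != j ->
    forall U : set 'rV[R[i]]_(total_size b).+1, domain U ->
    let X := block_coord (b := b) in
    let inv := coadjoint_invariant br e U in
    (* (A) *)
    [/\ lam i != 0 -> lam j != 0 ->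
          forall p q : 'rV[R[i]]_(total_size b).+1 -> R[i],
          complex_power_branch U (X i 1%N) (- lam j) p ->
          complex_power_branch U (X j 1%N) (lam i) q ->
          inv (fun x => p x * q x),
        (2 <= r i)%N -> lam i = 0 -> (2 <= r j)%N -> lam j = 0 ->
          inv (fun x => X j 2%N x * X i 1%N x - X i 2%N x * X j 1%N x),
        (2 <= r i)%N -> lam i != 0 -> (2 <= r j)%N -> lam j = 0 ->
          (forall x, U x -> X j 1%N x != 0 /\ X i 1%N x != 0) ->
          inv (fun x => X j 2%N x / X j 1%N x - X i 2%N x / X i 1%N x)
      & r i = 1%N -> lam i != 0 -> (2 <= r j)%N -> lam j = 0 ->
          (forall x, U x -> X j 1%N x != 0) ->
          inv (fun x =>
            X i 1%N x * cexp (- lam i * (X j 2%N x / X j 1%N x)))]).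
Proof.
split.
- move=> s b g br e adm aa i j _ U dU X inv; have oU : open U by case: dU.
  have dX k m x : differentiable (X k m) x by exact: differentiable_block_coord.
  split.
  + move=> ri li rj lj bi bj.
    have ri0 : (0 < ri)%N by have := adm i; rewrite bi => -[].
    have rj0 : (0 < rj)%N by have := adm j; rewrite bj => -[].
    split.
    * move=> _ _ p q pP qP.
      have [dp Dp] := real_power_branch_derive oU (fun x _ => dX i 1%N x) pP.
      have [dq Dq] := real_power_branch_derive oU (fun x _ => dX j 1%N x) qP.
      apply: (invariant_power_product aa dU bi bj) => // x Ux.
        (* The existence of a power branch already forces its base to be nonzero on U. *)
        by split; [case: pP => ? /(_ _ Ux)[]|case: qP => ? /(_ _ Ux)[]].
      by split; [exact: dp|exact: dq].
    * move=> ri2 li0 rj2 lj0; rewrite li0 in bi; rewrite lj0 in bj.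
      exact: (invariant_nilpotent_pair aa dU bi bj).
    * by move=> ri2 _ rj2 _; exact: (invariant_jordan_jordan_quotient aa dU bi bj).
    * move=> _ _ rj2 lj0; rewrite lj0 in bj.
      exact: (invariant_jordan_jordan_exp aa dU (@is_derive_expR R) bi bj).
  + move=> ri li rj muj nuj bi bj.
    have ri0 : (0 < ri)%N by have := adm i; rewrite bi => -[].
    (* Admissibility provides nuj != 0, which the exponent li / nuj requires. *)
    have [rj0 /eqP nuj0] : (0 < rj)%N /\ nuj <> 0 by have := adm j; rewrite bj.
    split=> [ri2 rj2|_]; first exact: (invariant_jordan_real_quotient aa dU bi bj).
    exact: (invariant_jordan_real_exp aa dU bi bj).
  + move=> ri mui nui rj muj nuj bi bj.
    have ri0 : (0 < ri)%N by have := adm i; rewrite bi => -[].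
    have rj0 : (0 < rj)%N by have := adm j; rewrite bj => -[].
    split=> [ri2 rj2|_]; first exact: (invariant_real_real_quotient aa dU bi bj).
    exact: (invariant_real_real_angle aa dU bi bj).
- move=> s r lam b g br e adm aa i j _ U dU X inv.
  have r0 k : (0 < r k)%N by have [] := adm k.
  have bE k : b k = Jordan (r k) (lam k) by [].
  split.
  + move=> _ _ p q pP qP.
    have [i0 dp Dp] := complex_power_branch_derive (proj1 dU)
      (fun x _ => differentiable_block_coord i 1 x) pP.
    have [j0 dq Dq] := complex_power_branch_derive (proj1 dU)
      (fun x _ => differentiable_block_coord j 1 x) qP.
    exact: (invariant_power_product aa dU (bE i) (bE j) (r0 i) (r0 j)
      (fun x Ux => conj (i0 x Ux) (j0 x Ux))
      (fun x Ux => conj (dp x Ux) (dq x Ux)) Dp Dq).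
  + move=> ri2 li0 rj2 lj0; have bi := bE i; have bj := bE j.
    rewrite li0 in bi; rewrite lj0 in bj.
    exact: (invariant_nilpotent_pair aa dU bi bj).
  + move=> ri2 _ rj2 _.
    exact: (invariant_jordan_jordan_quotient aa dU (bE i) (bE j)).
  + move=> _ _ rj2 lj0; have bj := bE j; rewrite lj0 in bj.
    exact: (invariant_jordan_jordan_exp aa dU (@is_derive_cexp R) (bE i) bj).
Qed.
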